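(* Let $X\in\{\mathrm{FL},\,k\mathrm{M},\,k\mathrm{FL}\}$. Suppose there is a polynomial-time $\alpha$-approximation algorithm for ConFL (connected facility location), and a polynomial-time algorithm for the capacitated problem C$X$ (i.e. CFL, C$k$M or C$k$FL) that returns a solution of cost at most $\beta$ times the optimal cost of C$X$ while violating the capacities (respectively the cardinality bound) by a factor of at most $\gamma$. Then there is a polynomial-time algorithm for the connected capacitated problem ConC$X$ (i.e. ConCFL, ConC$k$M or ConC$k$FL) that returns a solution of cost at most $(\alpha+2\beta)$ times the optimal cost of ConC$X$, violating the capacities (respectively the cardinality bound) by a factor of at most $\gamma$ (so, in particular, with no violation if $\gamma=1$).
   Context: An instance consists of a finite set $V$ with a metric $c:V\times V\to\mathbb{R}_{\ge 0}$, a set of facilities $\mathcal{F}\subseteq V$ with opening costs $f_i\ge 0$, and a set of clients $\mathcal{C}\subseteq V$. A solution opens a set $\mathcal{F}'\subseteq\mathcal{F}$ and assigns clients by a map $\phi:\mathcal{C}\to\mathcal{F}'$; its facility cost is $\sum_{i\in\mathcal{F}'}f_i$ and its service cost is $\sum_{j\in\mathcal{C}}c(j,\phi(j))$. FL: minimise facility cost plus service cost. $k$FL: additionally a number $k$ is given and $|\mathcal{F}'|\le k$ is required. $k$M: $k$FL with $f_i=0$ for all $i$. Capacitated variants (prefix C): each facility $i$ has a capacity $u_i$ and $|\phi^{-1}(i)|\le u_i$ is required for all $i\in\mathcal{F}'$. Connected variants (prefix Con): the solution additionally specifies a Steiner tree $T$ in the complete graph on $V$ containing all facilities of $\mathcal{F}'$,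 and the connection cost $\sum_{e\in T}c(e)$ is added to the objective. ConFL is connected FL (no capacities, no cardinality bound); ConC$X$ has both the capacity and connectivity requirements. An algorithm is a $\beta$-approximation with $\gamma$-factor violation in capacities (resp. cardinality) if it returns a solution satisfying all constraints except that $|\phi^{-1}(i)|\le\gamma u_i$ (resp. $|\mathcal{F}'|\le\gamma k$), whose cost is at most $\beta$ times the optimum of the problem with the constraints unviolated. *)

(* Defs.v *)
From HB Require Import structures.
From Corelib Require Import PosDef.
From mathcomp Require Import all_boot all_order all_algebra.
From mathcomp Require Import reals.

Set Implicit Arguments.
Unset Strict Implicit.
Unset Printing Implicit Defensive.

Import Order.TTheory GRing.Theory Num.Theory.
Local Open Scope ring_scope.

(* Model of computation: a point-free form of Jones's WHILE language over
   binary trees.  The whole store is one tree.  Every executed command is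
   charged the size of the tree it is applied to, i.e. the cost of copying the
   data it handles; hence the size of a result never exceeds the time spent,
   and polynomial time here is polynomial time on Turing machines. *)

Inductive tree := Leaf | Node of tree & tree.

Fixpoint tsize (x : tree) : nat :=
  if x is Node l r then (tsize l + tsize r).+1 else 1%N.

Fixpoint tree_eqb (x y : tree) : bool :=
  match x, y with
  | Leaf, Leaf => true
  | Node l r, Node l' r' => tree_eqb l l' && tree_eqb r r'
  | _, _ => false
  end.

(* Leaf serves as "false" and as the empty list. *)
Definition tbool (b : bool) : tree := if b then Node Leaf Leaf else Leaf.

Inductive prog :=
  | PId | PNil | PHd | PTl | PEq
  | PCons of prog & prog
  | PSeq of prog & prog
  | PIf of prog & prog & prog
  | PWhile of prog & prog.

(* eval p x y t : on input x, the program p halts with output y in time t. *)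
Inductive eval : prog -> tree -> tree -> nat -> Prop :=
  | EvId x : eval PId x x (tsize x)
  | EvNil x : eval PNil x Leaf (tsize x)
  | EvHd x : eval PHd x (if x is Node l _ then l else Leaf) (tsize x)
  | EvTl x : eval PTl x (if x is Node _ r then r else Leaf) (tsize x)
  | EvEq x :
      eval PEq x (if x is Node l r then tbool (tree_eqb l r) else Leaf)
        (tsize x)
  | EvCons p q x y z t1 t2 :
      eval p x y t1 -> eval q x z t2 ->
      eval (PCons p q) x (Node y z) (tsize x + t1 + t2)
  | EvSeq p q x y z t1 t2 :
      eval p x y t1 -> eval q y z t2 ->
      eval (PSeq p q) x z (tsize x + t1 + t2)
  | EvIfTrue g p q x l r y t1 t2 :
      eval g x (Node l r) t1 -> eval p x y t2 ->
      eval (PIf g p q) x y (tsize x + t1 + t2)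
  | EvIfFalse g p q x y t1 t2 :
      eval g x Leaf t1 -> eval q x y t2 ->
      eval (PIf g p q) x y (tsize x + t1 + t2)
  | EvWhileDone g p x t1 :
      eval g x Leaf t1 ->
      eval (PWhile g p) x x (tsize x + t1)
  | EvWhileStep g p x l r y z t1 t2 t3 :
      eval g x (Node l r) t1 -> eval p x y t2 -> eval (PWhile g p) y z t3 ->
      eval (PWhile g p) x z (tsize x + t1 + t2 + t3).

Definition enc_list (T : Type) (e : T -> tree) (s : seq T) : tree :=
  foldr (fun a t => Node (e a) t) Leaf s.

(* Binary digits, least significant first. *)
Fixpoint enc_pos (p : positive) : tree :=
  match p with
  | xH => Leaf
  | xO p => Node (tbool false) (enc_pos p)
  | xI p => Node (tbool true) (enc_pos p)
  end.

Definition enc_nat (n : nat) : tree :=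
  if bin_of_nat n is Npos p then Node Leaf (enc_pos p) else Leaf.

(* Only used on nonnegative rationals, so no sign is recorded. *)
Definition enc_rat (q : rat) : tree :=
  Node (enc_nat `|numq q|%N) (enc_nat `|denq q|%N).

Definition enc_ord (n : nat) (i : 'I_n) : tree := enc_nat i.

Definition enc_pair (n : nat) (e : 'I_n * 'I_n) : tree :=
  Node (enc_ord e.1) (enc_ord e.2).

Inductive variant := FL | kM | kFL.

Record problem := Problem {
  base : variant;
  capacitated : bool;
  connected : bool }.

Definition ConFL : problem := Problem FL false true.
Definition Cap (X : variant) : problem := Problem X true false.
Definition ConCap (X : variant) : problem := Problem X true true.

Definition cardinality_bounded (P : problem) : bool :=
  if base P is FL then false else true.

(* One record of data for all the problems.  Fields that a problem does not
   use (capacities, cardinality bound) enter neither its encoding nor its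
   constraints; the values of ocost and cap outside facilities never matter. *)
Record instance := Instance {
  nverts : nat;
  dist : 'I_nverts -> 'I_nverts -> rat;
  dist_ge0 : forall x y, 0 <= dist x y;
  dist_eq0 : forall x y, dist x y = 0 <-> x = y;
  dist_sym : forall x y, dist x y = dist y x;
  dist_triangle : forall x y z, dist x z <= dist x y + dist y z;
  facilities : {set 'I_nverts};
  clients : {set 'I_nverts};
  ocost : 'I_nverts -> rat;
  ocost_ge0 : forall i, i \in facilities -> 0 <= ocost i;
  cap : 'I_nverts -> nat;
  bound : nat }.

Definition instance_of (P : problem) (I : instance) : Prop :=
  base P = kM -> forall i, i \in facilities I -> ocost i = 0.

Definition enc_instance (P : problem) (I : instance) : tree :=
  enc_list id
    [:: enc_nat (nverts I);
        enc_list (fun x => enc_list (fun y => enc_rat (dist x y))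
                                    (enum 'I_(nverts I)))
                 (enum 'I_(nverts I));
        enc_list (fun i => Node (enc_ord i) (enc_rat (ocost i)))
                 (enum (facilities I));
        enc_list (@enc_ord _) (enum (clients I));
        (if capacitated P
         then enc_list (fun i => Node (enc_ord i) (enc_nat (cap i)))
                       (enum (facilities I))
         else Leaf);
        (if cardinality_bounded P then enc_nat (bound I) else Leaf)].

(* The map assign is only meaningful on clients, and (tverts, tedges) only for
   connected problems. *)
Record solution (n : nat) := Solution {
  opened : {set 'I_n};
  assign : {ffun 'I_n -> 'I_n};
  tverts : {set 'I_n};
  tedges : {set 'I_n * 'I_n} }.

(* Subgraphs of the complete graph on 'I_n: an undirected edge is represented
   by exactly one of its two orientations. *)
Definition adj (n : nat) (E : {set 'I_n * 'I_n}) : rel 'I_n :=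
  fun x y => ((x, y) \in E) || ((y, x) \in E).

Definition is_graph (n : nat) (S : {set 'I_n}) (E : {set 'I_n * 'I_n}) : Prop :=
  forall x y, (x, y) \in E ->
    [/\ x \in S, y \in S, x != y & (y, x) \notin E].

Definition is_tree (n : nat) (S : {set 'I_n}) (E : {set 'I_n * 'I_n}) : Prop :=
  [/\ is_graph S E,
      S != set0,
      {in S &, forall x y, connect (adj E) x y} &
      forall s : seq 'I_n, (2 < size s)%N -> ~ ucycle (adj E) s].

Definition load (I : instance) (s : solution (nverts I)) (i : 'I_(nverts I)) :
    nat :=
  #|[set j in clients I | assign s j == i]|.

(* Feasibility when capacities are relaxed by a factor gcap and the cardinality
   bound by a factor gcard; the unrelaxed constraints are gcap = gcard = 1. *)
Definition feasible (R : realType) (P : problem) (gcap gcard : R)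
    (I : instance) (s : solution (nverts I)) : Prop :=
  [/\ opened s \subset facilities I,
      (forall j, j \in clients I -> assign s j \in opened s),
      (capacitated P -> forall i, i \in opened s ->
         (load s i)%:R <= gcap * (cap i)%:R),
      (cardinality_bounded P -> #|opened s|%:R <= gcard * (bound I)%:R) &
      (connected P ->
         is_tree (tverts s) (tedges s) /\ opened s \subset tverts s)].

Definition cost (P : problem) (I : instance) (s : solution (nverts I)) : rat :=
  \sum_(i in opened s) ocost i
  + \sum_(j in clients I) dist j (assign s j)
  + (if connected P then \sum_(e in tedges s) dist e.1 e.2 else 0).

Definition is_optimum (R : realType) (P : problem) (I : instance) (v : rat) :
    Prop :=
  (exists2 s : solution (nverts I), @feasible R P 1 1 I s & cost P s = v) /\
  (forall s, @feasible R P 1 1 I s -> v <= cost P s).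

(* t is a listing of A, in any order and possibly with repetitions. *)
Definition lists (T : finType) (e : T -> tree) (A : {set T}) (t : tree) : Prop :=
  exists2 s : seq T, t = enc_list e s & A =i s.

Definition describes (P : problem) (I : instance) (s : solution (nverts I))
    (y : tree) : Prop :=
  exists o a v e,
    [/\ y = enc_list id (if connected P then [:: o; a; v; e] else [:: o; a]),
        lists (@enc_ord _) (opened s) o,
        lists (@enc_pair _) [set (j, assign s j) | j in clients I] a,
        lists (@enc_ord _) (tverts s) v &
        lists (@enc_pair _) (tedges s) e].

Definition polynomial_time (P : problem) (p : prog) : Prop :=
  exists C d : nat, forall I, instance_of P I ->
    exists y t, eval p (enc_instance P I) y t /\
      (t <= C * tsize (enc_instance P I) ^ d)%N.

(* On infeasible instances there is no optimum, and only the running time is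
   constrained. *)
Definition approximates (R : realType) (P : problem) (beta gcap gcard : R)
    (p : prog) : Prop :=
  forall I, instance_of P I -> forall opt, is_optimum R P I opt ->
    exists y t (s : solution (nverts I)),
      [/\ eval p (enc_instance P I) y t,
          describes P s y,
          feasible P gcap gcard s &
          ratr (cost P s) <= beta * ratr opt].

Definition has_approximation (R : realType) (P : problem)
    (beta gcap gcard : R) : Prop :=
  exists p, polynomial_time P p /\ approximates P beta gcap gcard p.

(* Which of the two constraints may be violated. *)
Inductive violation := InCapacities | InCardinality.

Definition cap_factor (R : realType) (w : violation) (g : R) : R :=
  if w is InCapacities then g else 1.

Definition card_factor (R : realType) (w : violation) (g : R) : R :=
  if w is InCardinality then g else 1.

(* Main.v *)
(* Take the tree T of an approximate ConFL solution phi1 and the facilities and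
   assignment phi2 of an approximate capacitated solution.  Close the facilities
   that phi2 does not use, and connect every remaining facility i outside T to T
   by one edge from i to phi1 j, for some client j with phi2 j = i.  By the
   triangle inequality these edges cost at most the two service costs together,
   so the total is at most cost(phi1, T) + 2 cost(phi2), and both relaxations
   have optima at most that of the connected capacitated problem.

   The new vertices are leaves, so a single scan of the list of assignments
   builds the tree.  On infeasible instances the two given algorithms may return
   arbitrary trees, hence the combining program is shown to run in polynomial
   time on every input. *)

Require Import Defs.
From mathcomp Require Import all_boot all_order all_algebra.
From mathcomp Require Import boolp reals.
From mathcomp Require Import zify lra.
(* Otherwise [tsize] is that of [tuple]. *)
Import Defs.

Set Implicit Arguments.
Unset Strict Implicit.
Unset Printing Implicit Defensive.

Import Order.TTheory GRing.Theory Num.Theory.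

(** * Sizes, running times and polynomial bounds *)

Lemma tsize_gt0 x : 0 < tsize x.
Proof. by case: x. Qed.

Lemma tree_eqP x y : reflect (x = y) (tree_eqb x y).
Proof.
apply: (iffP idP) => [|<-]; last by elim: x => //= l -> r ->.
elim: x y => [|l IHl r IHr] [|l' r'] //= /andP[/IHl-> /IHr->] //.
Qed.

(** Every command pays for the tree it reads, so an output is built only from data already paid for.
    A time bound for one program thus bounds the input of the next. *)
Lemma tsize_eval p x y t : eval p x y t -> tsize y <= t.
Proof.
elim=> {p x y t} //=; try by move=> *; lia.
- by move=> x; exact: tsize_gt0.
- by case=> //= l r; lia.
- by case=> //= l r; lia.
- case=> //= l r; have := tsize_gt0 l; have := tsize_gt0 r.
  by case: tree_eqb => /=; lia.
- by move=> p q x y z t1 t2; have := tsize_gt0 x; lia.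
Qed.

(** Monotonicity allows composition of bounds; the base [n.+1] is positive, so exponents can be
    raised freely. *)
Definition poly_bound (h : nat -> nat) :=
  {homo h : m n / m <= n} /\ exists C d, forall n, h n <= C * n.+1 ^ d.

Lemma leq_exp2rW m n d : m <= n -> m ^ d <= n ^ d.
Proof. by case: d => // d; rewrite leq_exp2r. Qed.

Lemma poly_bound_const c : poly_bound (fun=> c).
Proof. by split=> //; exists c, 0 => n; rewrite muln1. Qed.

Lemma poly_bound_id : poly_bound id.
Proof. by split=> //; exists 1, 1 => n; rewrite mul1n expn1. Qed.

Lemma poly_bound_add h1 h2 :
  poly_bound h1 -> poly_bound h2 -> poly_bound (fun n => h1 n + h2 n).
Proof.
move=> [m1 [C1 [d1 b1]]] [m2 [C2 [d2 b2]]]; split.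
  by move=> m n le_mn; rewrite leq_add ?m1 ?m2.
exists (C1 + C2), (d1 + d2) => n; rewrite mulnDl leq_add //.
  by rewrite (leq_trans (b1 n)) // leq_mul2l leq_pexp2l ?orbT ?leq_addr.
by rewrite (leq_trans (b2 n)) // leq_mul2l leq_pexp2l ?orbT ?leq_addl.
Qed.

Lemma poly_bound_mul h1 h2 :
  poly_bound h1 -> poly_bound h2 -> poly_bound (fun n => h1 n * h2 n).
Proof.
move=> [m1 [C1 [d1 b1]]] [m2 [C2 [d2 b2]]]; split.
  by move=> m n le_mn; rewrite leq_mul ?m1 ?m2.
by exists (C1 * C2), (d1 + d2) => n; rewrite expnD mulnACA leq_mul.
Qed.

Lemma poly_bound_comp h1 h2 :
  poly_bound h1 -> poly_bound h2 -> poly_bound (fun n => h2 (h1 n)).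
Proof.
move=> [m1 [C1 [d1 b1]]] [m2 [C2 [d2 b2]]]; split.
  by move=> m n le_mn; rewrite m2 ?m1.
exists (C2 * C1.+1 ^ d2), (d1 * d2) => n.
rewrite (leq_trans (b2 _)) // -mulnA leq_mul2l expnM -expnMn.
rewrite leq_exp2rW ?orbT // mulSn addnC -addn1 leq_add ?expn_gt0 //.
Qed.

Lemma poly_bound_monomial C d : poly_bound (fun n => C * n ^ d).
Proof.
split=> [m n le_mn|]; first by rewrite leq_mul2l leq_exp2rW ?orbT.
by exists C, d => n; rewrite leq_mul2l leq_exp2rW ?orbT.
Qed.

(** For positive [n], [n.+1] is at most [2 * n]; this yields the shape required by
    [polynomial_time], as tree sizes are positive. *)
Lemma poly_bound_pos h : poly_bound h ->
  exists C d, forall n, 0 < n -> h n <= C * n ^ d.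
Proof.
move=> [_ [C [d b]]]; exists (C * 2 ^ d), d => n n0.
rewrite (leq_trans (b n)) // -mulnA -expnMn leq_mul2l leq_exp2rW ?orbT //; lia.
Qed.

(** * Polynomial-time programs and their composition *)

Definition ptime (p : prog) (f : tree -> tree) :=
  exists2 h, poly_bound h &
    forall x, exists2 t, eval p x (f x) t & t <= h (tsize x).

Definition thd x := if x is Node l _ then l else Leaf.
Definition ttl x := if x is Node _ r then r else Leaf.
Definition teq x := if x is Node l r then tbool (tree_eqb l r) else Leaf.

Lemma ptime_atom p f : (forall x, eval p x (f x) (tsize x)) -> ptime p f.
Proof.
by move=> e; exists id => [|x]; [exact: poly_bound_id|exists (tsize x)].
Qed.

Lemma ptime_nil : ptime PNil (fun=> Leaf).
Proof.
by apply: ptime_atom => x; constructor.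
Qed.

Lemma ptime_hd : ptime PHd thd.
Proof.
by apply: ptime_atom => x; constructor.
Qed.

Lemma ptime_tl : ptime PTl ttl.
Proof.
by apply: ptime_atom => x; constructor.
Qed.

Lemma ptime_eq : ptime PEq teq.
Proof.
by apply: ptime_atom => x; constructor.
Qed.

Lemma ptime_cons p q f g : ptime p f -> ptime q g ->
  ptime (PCons p q) (fun x => Node (f x) (g x)).
Proof.
move=> [h1 b1 e1] [h2 b2 e2]; exists (fun n => n + h1 n + h2 n).
  by do !apply: poly_bound_add => //; exact: poly_bound_id.
move=> x; have [t1 E1 l1] := e1 x; have [t2 E2 l2] := e2 x.
by exists (tsize x + t1 + t2); [constructor|lia].
Qed.

Lemma ptime_seq p q f g : ptime p f -> ptime q g ->
  ptime (PSeq p q) (fun x => g (f x)).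
Proof.
move=> [h1 b1 e1] [h2 b2 e2]; exists (fun n => n + h1 n + h2 (h1 n)).
  apply: poly_bound_add; last exact: poly_bound_comp.
  by apply: poly_bound_add => //; exact: poly_bound_id.
move=> x; have [t1 E1 l1] := e1 x; have [t2 E2 l2] := e2 (f x).
exists (tsize x + t1 + t2); first by econstructor; eauto.
have /b2.1 := leq_trans (tsize_eval E1) l1; lia.
Qed.

Lemma ptime_if b p q fb f g : ptime b fb -> ptime p f -> ptime q g ->
  ptime (PIf b p q) (fun x => if fb x is Node _ _ then f x else g x).
Proof.
move=> [h0 b0 e0] [h1 b1 e1] [h2 b2 e2].
exists (fun n => n + h0 n + (h1 n + h2 n)).
  by do !apply: poly_bound_add => //; exact: poly_bound_id.
move=> x; have [t0 E0 l0] := e0 x; case: (fb x) E0 => [|l r] E0.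
  have [t2 E2 l2] := e2 x.
  by exists (tsize x + t0 + t2); [apply: EvIfFalse|lia].
have [t1 E1 l1] := e1 x.
by exists (tsize x + t0 + t1); [apply: EvIfTrue; eauto|lia].
Qed.

(** * Folding over a list in polynomial time *)

(** Programs have no variables, so the item, a constant argument and the state are packed into one
    tree. *)
Fixpoint tfold (f : tree -> tree) (l c s : tree) : tree :=
  if l is Node a l' then tfold f l' c (f (Node a (Node c s))) else s.

(** The store is [Node l (Node c s)]; its head is the remaining list, which is [Leaf] exactly when
    the loop must stop. *)
Definition ploop (step : prog) : prog :=
  PWhile PHd
    (PCons (PSeq PHd PTl)
       (PCons (PSeq PTl PHd) (PSeq (PCons (PSeq PHd PHd) PTl) step))).

Definition pfold (step pl pc ps : prog) : prog :=
  PSeq (PCons pl (PCons pc ps)) (PSeq (ploop step) (PSeq PTl PTl)).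

(* The bound on [f] is additive in the state, so that the state stays of
   polynomial size throughout the loop. *)
Lemma ptime_fold step pl pc ps f fl fc fs K :
  (forall a c s,
     tsize (f (Node a (Node c s))) <= tsize s + K * (tsize a + tsize c)) ->
  ptime step f -> ptime pl fl -> ptime pc fc -> ptime ps fs ->
  ptime (pfold step pl pc ps) (fun x => tfold f (fl x) (fc x) (fs x)).
Proof.
move=> fK pf pfl pfc pfs.
pose state x := Node (fl x) (Node (fc x) (fs x)).
have [h0 b0 e0] : ptime (PCons pl (PCons pc ps)) state.
  by do !apply: ptime_cons.
have [hb bb eb] : ptime (PCons (PSeq PHd PTl)
       (PCons (PSeq PTl PHd) (PSeq (PCons (PSeq PHd PHd) PTl) step)))
    (fun x => Node (ttl (thd x))
       (Node (thd (ttl x)) (f (Node (thd (thd x)) (ttl x))))).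
  apply: ptime_cons; first exact: (ptime_seq ptime_hd ptime_tl).
  apply: ptime_cons; first exact: (ptime_seq ptime_tl ptime_hd).
  apply: ptime_seq pf.
  apply: ptime_cons ptime_tl; exact: (ptime_seq ptime_hd ptime_hd).
have [h3 b3 e3] : ptime (PSeq PTl PTl) (fun x => ttl (ttl x)).
  exact: (ptime_seq ptime_tl ptime_tl).
(* [M] bounds every store of the loop: consuming an item [a] frees
   [K * (tsize a + 1) * (1 + tsize c)], which covers the growth of the state. Each round costs at
   most [2 * M + hb M], and [tsize l] exceeds the number of rounds. *)
have loop M l c s :
    tsize s + K * tsize l * (1 + tsize c) + tsize l + tsize c + 2 <= M ->
  exists2 t, eval (ploop step) (Node l (Node c s))
               (Node Leaf (Node c (tfold f l c s))) t &
    t <= tsize l * (2 * M + hb M).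
  elim: l s => [|a _ l IHl] s le_M /=.
    exists (tsize (Node Leaf (Node c s)) + tsize (Node Leaf (Node c s))).
      by apply: EvWhileDone; constructor.
    move: le_M => /=; lia.
  have [t2 E2 l2] := eb (Node (Node a l) (Node c s)).
  have [|t3 E3 l3] := IHl (f (Node a (Node c s))).
    by move: le_M (fK a c s) => /=; nia.
  have sM : tsize (Node (Node a l) (Node c s)) <= M.
    by move: le_M => /=; nia.
  exists (tsize (Node (Node a l) (Node c s)) +
          tsize (Node (Node a l) (Node c s)) + t2 + t3).
    apply: EvWhileStep E2 E3; exact: (EvHd (Node (Node a l) (Node c s))).
  have le_W := bb.1 _ _ sM.
  have := leq_addl (tsize a * (2 * M + hb M))
                   (2 * M + hb M + tsize l * (2 * M + hb M)).
  by move: sM => /=; rewrite (mulSn (_ + _)) (mulnDl (tsize a)); lia.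
(* The size of the initial store bounds each of its three components, so [B] of it is a valid
   [M]. *)
pose B n := n + K * n * (1 + n) + n + n + 2.
have bB : poly_bound B.
  rewrite /B.
  by repeat first [apply: poly_bound_add | apply: poly_bound_mul
    | exact: poly_bound_id | exact: poly_bound_const].
pose hl n := n * (2 * B n + hb (B n)).
have bl : poly_bound hl.
  apply: poly_bound_mul; first exact: poly_bound_id.
  apply: poly_bound_add; last exact: poly_bound_comp.
  by apply: poly_bound_mul => //; exact: poly_bound_const.
have ht : poly_bound
    (fun n => n + h0 n + (h0 n + hl (h0 n) + h3 (hl (h0 n)))).
  apply: poly_bound_add.
    by apply: poly_bound_add => //; exact: poly_bound_id.
  apply: poly_bound_add.
    by apply: poly_bound_add => //; exact: poly_bound_comp.
  by apply: poly_bound_comp => //; exact: poly_bound_comp.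
exists (fun n => n + h0 n + (h0 n + hl (h0 n) + h3 (hl (h0 n)))) => //.
move=> x; have [t0 E0 l0] := e0 x.
have sz := leq_trans (tsize_eval E0) l0.
have [|t1 E1 l1] := loop (B (h0 (tsize x))) (fl x) (fc x) (fs x).
  by move: sz; rewrite /B /=; nia.
have {}l1 : t1 <= hl (h0 (tsize x)).
  by apply: leq_trans l1 _; rewrite leq_mul2r; apply/orP; right; move: sz => /=; lia.
have [t2 E2 l2] := e3 (Node Leaf (Node (fc x) (tfold f (fl x) (fc x) (fs x)))).
exists (tsize x + t0 + (tsize (state x) + t1 + t2)).
  exact: EvSeq E0 (EvSeq E1 E2).
have /b3.1 := leq_trans (tsize_eval E1) l1.
move: sz l0 l1 l2; rewrite /state; lia.
Qed.

(** * Programs for membership, lookup and combining two outputs *)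

Definition mem_step : prog :=
  PIf (PSeq (PCons PHd (PSeq PTl PHd)) PEq) (PCons PNil PNil) (PSeq PTl PTl).

Definition mem_stepf x :=
  if teq (Node (thd x) (thd (ttl x))) is Node _ _ then Node Leaf Leaf
  else ttl (ttl x).

Lemma ptime_mem_step : ptime mem_step mem_stepf.
Proof.
apply: ptime_if.
- apply: ptime_seq ptime_eq; apply: ptime_cons ptime_hd _.
  exact: (ptime_seq ptime_tl ptime_hd).
- exact: (ptime_cons ptime_nil ptime_nil).
- exact: (ptime_seq ptime_tl ptime_tl).
Qed.

Definition tmem l a := tfold mem_stepf l a Leaf.

Definition lookup_step : prog :=
  PIf (PSeq (PCons (PSeq PHd PHd) (PSeq PTl PHd)) PEq) (PSeq PHd PTl)
    (PSeq PTl PTl).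

Definition lookup_stepf x :=
  if teq (Node (thd (thd x)) (thd (ttl x))) is Node _ _ then ttl (thd x)
  else ttl (ttl x).

Lemma ptime_lookup_step : ptime lookup_step lookup_stepf.
Proof.
apply: ptime_if.
- apply: ptime_seq ptime_eq; apply: ptime_cons.
    exact: (ptime_seq ptime_hd ptime_hd).
  exact: (ptime_seq ptime_tl ptime_hd).
- exact: (ptime_seq ptime_hd ptime_tl).
- exact: (ptime_seq ptime_tl ptime_tl).
Qed.

(** There is no early exit, so the last pair with key [a] decides; [Leaf] is the default. *)
Definition tlookup l a := tfold lookup_stepf l a Leaf.

Lemma tsize_ttl x : tsize (ttl x) <= tsize x.
Proof. case: x => //= l r; lia. Qed.

Lemma ptime_mem pl pa fl fa : ptime pl fl -> ptime pa fa ->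
  ptime (pfold mem_step pl pa PNil) (fun x => tmem (fl x) (fa x)).
Proof.
(* The flag [Node Leaf Leaf] has size 3. *)
move=> Pl Pa; apply: (ptime_fold (K := 3)) ptime_mem_step Pl Pa ptime_nil.
move=> a c s; rewrite /mem_stepf /=; have := tsize_gt0 a.
by case: tree_eqb => /=; lia.
Qed.

(** The state is replaced, never extended, hence a maximum instead of a sum; iterating it keeps the
    result no larger than the list. *)
Lemma tsize_lookup_step a c s :
  tsize (lookup_stepf (Node a (Node c s))) <= maxn (tsize a) (tsize s).
Proof.
rewrite /lookup_stepf /=; have := tsize_ttl a.
by case: tree_eqb => /=; lia.
Qed.

Lemma ptime_lookup pl pa fl fa : ptime pl fl -> ptime pa fa ->
  ptime (pfold lookup_step pl pa PNil) (fun x => tlookup (fl x) (fa x)).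
Proof.
move=> Pl Pa; apply: (ptime_fold (K := 1)) ptime_lookup_step Pl Pa ptime_nil.
by move=> a c s; have := tsize_lookup_step a c s; lia.
Qed.

Lemma tsize_lookup l a : tsize (tlookup l a) <= tsize l.
Proof.
suff: forall s, tsize (tfold lookup_stepf l a s) <= maxn (tsize l) (tsize s).
  by move/(_ Leaf)/leq_trans; apply; rewrite geq_max leqnn tsize_gt0.
elim: l => [|b _ l IHl] s /=; first lia.
have := IHl (lookup_stepf (Node b (Node a s))).
by have := tsize_lookup_step b a s; lia.
Qed.

(* The state is (o, (v, e)) and the constant argument the list of the
   assignments of the ConFL solution; the item (j, i) attaches i as a leaf to
   the facility serving j in that solution. *)
Definition attach_stepf x :=
  let i := ttl (thd x) in
  let o := thd (ttl (ttl x)) in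
  let ve := ttl (ttl (ttl x)) in
  Node (Node i o)
    (if tmem (thd ve) i is Node _ _ then ve
     else Node (Node i (thd ve))
            (Node (Node i (tlookup (thd (ttl x)) (thd (thd x)))) (ttl ve))).

Definition pi_item := PSeq PHd PTl.
Definition ve_item := PSeq PTl (PSeq PTl PTl).

Definition attach_step : prog :=
  PCons (PCons pi_item (PSeq PTl (PSeq PTl PHd)))
    (PIf (pfold mem_step (PSeq ve_item PHd) pi_item PNil) ve_item
       (PCons (PCons pi_item (PSeq ve_item PHd))
          (PCons (PCons pi_item
                    (pfold lookup_step (PSeq PTl PHd) (PSeq PHd PHd) PNil))
             (PSeq ve_item PTl)))).

Lemma ptime_attach_step : ptime attach_step attach_stepf.
Proof.
have Pi : ptime pi_item (fun x => ttl (thd x)).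
  exact: (ptime_seq ptime_hd ptime_tl).
have Pve : ptime ve_item (fun x => ttl (ttl (ttl x))).
  exact: (ptime_seq ptime_tl (ptime_seq ptime_tl ptime_tl)).
apply: ptime_cons.
  apply: (ptime_cons Pi).
  exact: (ptime_seq ptime_tl (ptime_seq ptime_tl ptime_hd)).
apply: (ptime_if (ptime_mem (ptime_seq Pve ptime_hd) Pi) Pve).
apply: ptime_cons; first exact: (ptime_cons Pi (ptime_seq Pve ptime_hd)).
apply: (ptime_cons _ (ptime_seq Pve ptime_tl)).
apply: (ptime_cons Pi).
exact: (ptime_lookup (ptime_seq ptime_tl ptime_hd) (ptime_seq ptime_hd ptime_hd)).
Qed.

(** The facility is copied three times and one looked-up value, no larger than [c], is added; the
    factor 10 leaves room for the new nodes. *)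
Lemma tsize_attach_step a c s :
  tsize (attach_stepf (Node a (Node c s))) <= tsize s + 10 * (tsize a + tsize c).
Proof.
have := tsize_ttl a; have := tsize_gt0 c; have := tsize_gt0 a.
have := tsize_lookup c (thd a); rewrite /attach_stepf /=.
(* The [+ 1] is for [Leaf], both of whose projections are [Leaf]. *)
have : tsize (thd s) + tsize (ttl s) <= tsize s + 1.
  by case: s => //= l r; lia.
have : tsize (thd (ttl s)) + tsize (ttl (ttl s)) <= tsize (ttl s) + 1.
  by case: (ttl s) => //= l r; lia.
by case: tmem => /= *; lia.
Qed.

(* The input is a pair of an output for ConFL and one for the capacitated
   problem. *)
Definition combinef x :=
  let a2 := thd (ttl (ttl x)) in
  let a1 := thd (ttl (thd x)) in
  let ve := ttl (ttl (thd x)) in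
  let r := tfold attach_stepf a2 a1 (Node Leaf (Node (thd ve) (thd (ttl ve)))) in
  Node (thd r) (Node a2 (Node (thd (ttl r)) (Node (ttl (ttl r)) Leaf))).

Definition combine : prog :=
  let a2 := PSeq PTl (PSeq PTl PHd) in
  let a1 := PSeq PHd (PSeq PTl PHd) in
  let ve := PSeq PHd (PSeq PTl PTl) in
  let r := pfold attach_step a2 a1
    (PCons PNil (PCons (PSeq ve PHd) (PSeq ve (PSeq PTl PHd)))) in
  PCons (PSeq r PHd)
    (PCons a2 (PCons (PSeq r (PSeq PTl PHd))
                 (PCons (PSeq r (PSeq PTl PTl)) PNil))).

Lemma ptime_combine : ptime combine combinef.
Proof.
have a2 : ptime (PSeq PTl (PSeq PTl PHd)) (fun x => thd (ttl (ttl x))).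
  exact: (ptime_seq ptime_tl (ptime_seq ptime_tl ptime_hd)).
have a1 : ptime (PSeq PHd (PSeq PTl PHd)) (fun x => thd (ttl (thd x))).
  exact: (ptime_seq ptime_hd (ptime_seq ptime_tl ptime_hd)).
have ve : ptime (PSeq PHd (PSeq PTl PTl)) (fun x => ttl (ttl (thd x))).
  exact: (ptime_seq ptime_hd (ptime_seq ptime_tl ptime_tl)).
have init := ptime_cons ptime_nil (ptime_cons (ptime_seq ve ptime_hd)
  (ptime_seq ve (ptime_seq ptime_tl ptime_hd))).
have r := ptime_fold tsize_attach_step ptime_attach_step a2 a1 init.
apply: ptime_cons; first exact: (ptime_seq r ptime_hd).
apply: (ptime_cons a2).
apply: ptime_cons; first exact: (ptime_seq r (ptime_seq ptime_tl ptime_hd)).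
exact: (ptime_cons (ptime_seq r (ptime_seq ptime_tl ptime_tl)) ptime_nil).
Qed.

(** Blanking the capacity and cardinality fields turns the input into the encoding of a ConFL
    instance. *)
Definition strip : prog :=
  let tl2 := PSeq PTl PTl in
  PCons PHd (PCons (PSeq PTl PHd) (PCons (PSeq tl2 PHd)
    (PCons (PSeq tl2 (PSeq PTl PHd))
       (PCons PNil (PCons PNil PNil))))).

Definition stripf x :=
  Node (thd x) (Node (thd (ttl x)) (Node (thd (ttl (ttl x)))
    (Node (thd (ttl (ttl (ttl x)))) (Node Leaf (Node Leaf Leaf))))).

Lemma ptime_strip : ptime strip stripf.
Proof.
have tl2 := ptime_seq ptime_tl ptime_tl.
apply: ptime_cons ptime_hd _.
apply: ptime_cons (ptime_seq ptime_tl ptime_hd) _.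
apply: ptime_cons (ptime_seq tl2 ptime_hd) _.
apply: ptime_cons (ptime_seq tl2 (ptime_seq ptime_tl ptime_hd)) _.
by do !apply: ptime_cons ptime_nil _; exact: ptime_nil.
Qed.

Lemma stripE X I :
  stripf (enc_instance (ConCap X) I) = enc_instance ConFL I.
Proof. by []. Qed.

Local Open Scope ring_scope.

(** * Attaching a leaf to a tree *)

Lemma adj_sym n (E : {set 'I_n * 'I_n}) : symmetric (adj E).
Proof. by move=> x y; rewrite /adj orbC. Qed.

Lemma adj_mem n (S : {set 'I_n}) E x y :
  is_graph S E -> adj E x y -> x \in S /\ y \in S.
Proof. by move=> gE /orP[] /gE[]. Qed.

(** The only neighbour of [i] is [z], so a cycle through [i] would visit [z] twice, and a cycle
    avoiding [i] lies in the old tree. *)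
Lemma is_tree_leaf n (S : {set 'I_n}) E i z :
  is_tree S E -> z \in S -> i \notin S ->
  is_tree (i |: S) ((i, z) |: E).
Proof.
move=> [gE S0 cE aE] zS iS.
have iz : i != z by apply: contraNneq iS => ->.
have adjU x y : adj ((i, z) |: E) x y =
    [|| (x == i) && (y == z), (x == z) && (y == i) | adj E x y].
  by rewrite /adj !in_setU1 !xpair_eqE orbACA [(y == i) && _]andbC -orbA.
have adji x : adj ((i, z) |: E) i x = (x == z).
  rewrite adjU eqxx (negPf iz) /=; case: eqP => //= _.
  by apply/negP => /(adj_mem gE) [iS' _]; rewrite iS' in iS.
split.
- move=> x y /setU1P[[-> ->]|xyE].
    split; rewrite ?inE ?eqxx ?zS ?orbT // xpair_eqE eq_sym (negPf iz) /=.
    by apply/negP => /gE[_ iS' _ _]; rewrite iS' in iS.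
  have [xS yS xy yxE] := gE _ _ xyE.
  split; rewrite ?inE ?xS ?yS ?orbT // negb_or yxE xpair_eqE andbT.
  by apply: contra iS => /andP[/eqP <-].
- by apply/set0Pn; exists i; rewrite setU11.
- have csym := sym_connect_sym (@adj_sym _ ((i, z) |: E)).
  have cz x : x \in i |: S -> connect (adj ((i, z) |: E)) z x.
    case/setU1P => [->|xS].
      by rewrite csym connect1 // adji.
    apply: (connect_sub _ (cE z x zS xS)) => u v uv.
    by rewrite connect1 // adjU uv !orbT.
  by move=> x y /cz zx /cz zy; apply: connect_trans zy; rewrite csym.
- move=> s s2 /andP[cs us].
  case: (boolP (i \in s)) => [i_s|iNs]; last first.
    apply: (aE s s2); rewrite /ucycle us andbT.
    rewrite -(eq_in_cycle (P := predC1 i) (e := adj ((i, z) |: E))) //.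
      by move=> x y /= /negPf xi /negPf yi; rewrite adjU xi yi andbF.
    by apply/allP => x xs /=; apply: contraNneq iNs => <-.
  have [k s' Es] := rot_to i_s.
  move: cs us s2; rewrite -(rot_cycle k) -(rot_uniq k) -(size_rot k) Es.
  (* The cycle, rotated to start at [i], has at least three vertices, so its second and last
     positions are distinct; both are occupied by [z]. *)
  case: s' {Es} => [|a s'] //; case/lastP: s' => // s' b.
  rewrite /= rcons_path last_rcons adji adj_sym adji.
  move=> /and3P[/eqP-> _ /eqP->] /and3P[_ + _] _.
  by rewrite mem_rcons mem_head.
Qed.

(** * Existence of optima and sign of the approximation factors *)

(** Solutions correspond to tuples from a finite type, over which the cost attains its minimum. *)
Lemma feasible_optimum (R : realType) P I (s : solution (nverts I)) :
  feasible P (1 : R) 1 s ->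
  exists s' : solution (nverts I),
    feasible P (1 : R) 1 s' /\ is_optimum R P I (cost P s').
Proof.
move=> fs; pose V := 'I_(nverts I).
pose mk (x : {set V} * {ffun V -> V} * ({set V} * {set V * V})) :=
  Solution x.1.1 x.1.2 x.2.1 x.2.2.
pose un (s : solution (nverts I)) :=
  ((opened s, assign s), (tverts s, tedges s)).
have mkK s' : mk (un s') = s' by case: s'.
have fx0 : `[< feasible P (1 : R) 1 (mk (un s)) >].
  by apply/asboolP; rewrite mkK.
case: (arg_minP (P := fun x => `[< feasible P (1 : R) 1 (mk x) >])
  (fun x => cost P (mk x)) fx0) => x /asboolP fx min_x.
exists (mk x); split=> //; split; first by exists (mk x).
by move=> s' fs'; rewrite -[s']mkK min_x //; apply/asboolP; rewrite mkK.
Qed.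

Lemma cost_ge0 (R : realType) P I (g1 g2 : R) (s : solution (nverts I)) :
  feasible P g1 g2 s -> 0 <= cost P s.
Proof.
move=> [oF _ _ _ _]; rewrite /cost !addr_ge0 //.
- by rewrite sumr_ge0 // => i /(subsetP oF); exact: ocost_ge0.
- by rewrite sumr_ge0 // => j _; exact: dist_ge0.
- by case: ifP => // _; rewrite sumr_ge0 // => e _; exact: dist_ge0.
Qed.

Definition two_points : instance.
Proof.
refine (@Instance 2 (fun x y => (x != y)%:R) _ _ _ _ [set ord0] [set ord_max]
  (fun=> 0) _ (fun=> 1%N) 1%N) => //.
- by move=> x y; case: eqVneq => [->|/eqP xy]; split=> // /eqP; rewrite oner_eq0.
- by move=> x y; rewrite eq_sym.
- move=> x y z; rewrite -natrD ler_nat; case: (eqVneq x y) => [->|_] //=.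
  by case: eqP.
Defined.

Lemma is_tree1 n (x : 'I_n) : is_tree [set x] set0.
Proof.
split.
- by move=> y z; rewrite inE.
- by apply/set0Pn; exists x; rewrite set11.
- by move=> y z /set1P-> /set1P->; exact: connect0.
- by move=> [|a [|b s]] //= _ /andP[/= /andP[+ _] _]; rewrite /adj !inE.
Qed.

(* If b were negative, the instance [two_points], whose optimum is positive,
   would force a negative cost; its opening costs vanish because kM requires
   so. *)
Lemma approximates_ge0 (R : realType) P (b g1 g2 : R) p :
  approximates P b g1 g2 p -> 0 <= b.
Proof.
move=> ap.
pose s0 := @Solution 2 [set ord0] [ffun=> ord0] [set ord0] set0.
have fs0 : @feasible R P 1 1 two_points s0.
  split=> //=.
  - by move=> j _; rewrite ffunE set11.
  - move=> _ i _; rewrite mul1r ler_nat -(cards1 (ord_max : 'I_2)) subset_leq_card //.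
    by apply/subsetP => j /setIdP[].
  - by move=> _; rewrite cards1 mul1r.
  - by move=> _; split=> //; exact: is_tree1.
have [s [fs os]] := feasible_optimum fs0.
have [//|y [t [s' [_ _ fs' cs']]]] := ap _ _ _ os.
have cs0 : 0 < cost P s.
  have [oF aO _ _ _] := fs.
  rewrite /cost /= big1 // add0r big_set1.
  (* The client must go to the only facility, which is the other point, at distance 1. *)
  have /(subsetP oF)/set1P -> := aO _ (set11 _).
  rewrite ltr_wpDr //; case: ifP => // _.
  by rewrite sumr_ge0 // => e _; rewrite ler0n.
have : 0 <= ratr (cost P s') :> R by rewrite ler0q (cost_ge0 fs').
move/le_trans/(_ cs').
by rewrite pmulr_lge0 // ltr0q.
Qed.

(** * Correctness of the list programs on encoded data *)

Lemma enc_pos_inj : injective enc_pos.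
Proof. by elim=> [p IHp|p IHp|] [q|q|] //= [] /IHp ->. Qed.

Lemma enc_nat_inj : injective enc_nat.
Proof.
move=> m n; rewrite /enc_nat => E; apply: (can_inj bin_of_natK).
by case: (bin_of_nat m) (bin_of_nat n) E => [|p] [|q] // [/enc_pos_inj ->].
Qed.

Lemma tree_eqb_ord n (i j : 'I_n) : tree_eqb (enc_ord i) (enc_ord j) = (i == j).
Proof. by apply/tree_eqP/eqP => [/enc_nat_inj/val_inj|->]. Qed.

Lemma tmem_enc n (s : seq 'I_n) i :
  tmem (enc_list (@enc_ord n) s) (enc_ord i) = tbool (i \in s).
Proof.
suff: forall b, tfold mem_stepf (enc_list (@enc_ord n) s) (enc_ord i) (tbool b)
    = tbool (b || (i \in s)) by move/(_ false).
elim: s => [|a s IHs] b /=; first by rewrite orbF.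
rewrite /mem_stepf /= tree_eqb_ord inE eq_sym.
by case: eqP => _ /=; [rewrite (IHs true) orbT|rewrite IHs].
Qed.

(** All pairs with key [j] agree because [s] lies in the graph of [phi], so repetitions are
    harmless. *)
Lemma tlookup_enc n (phi : 'I_n -> 'I_n) (s : seq ('I_n * 'I_n)) j :
  (forall p, p \in s -> p.2 = phi p.1) -> (j, phi j) \in s ->
  tlookup (enc_list (@enc_pair n) s) (enc_ord j) = enc_ord (phi j).
Proof.
move=> sphi js.
suff: forall r, tfold lookup_stepf (enc_list (@enc_pair n) s) (enc_ord j) r
    = if j \in map fst s then enc_ord (phi j) else r.
  by move/(_ Leaf); rewrite (map_f fst js).
elim: s sphi {js} => [|[a b] s IHs] sphi r //=.
have {}IHs := IHs (fun p ps => sphi p (mem_behead (s := (a, b) :: s) ps)).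
rewrite IHs /lookup_stepf /= tree_eqb_ord inE eq_sym.
have /= -> := sphi _ (mem_head (a, b) s).
by case: eqP => [->|_] //=; case: ifP.
Qed.

(** * Correctness and cost of the combined solution *)

(** Mirrors the tree part of [attach_stepf] on decoded sequences, with [phi] in place of the
    lookup. *)
Definition attach n (phi : 'I_n -> 'I_n)
    (ve : seq 'I_n * seq ('I_n * 'I_n)) (p : 'I_n * 'I_n) :=
  if p.2 \in ve.1 then ve else (p.2 :: ve.1, (p.2, phi p.1) :: ve.2).

Definition enc_state n (o : seq 'I_n) (ve : seq 'I_n * seq ('I_n * 'I_n)) :=
  Node (enc_list (@enc_ord n) o)
    (Node (enc_list (@enc_ord n) ve.1) (enc_list (@enc_pair n) ve.2)).

Lemma tfold_attach n (phi : 'I_n -> 'I_n) (l s : seq ('I_n * 'I_n)) o ve :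
  (forall p, p \in s -> p.2 = phi p.1) ->
  (forall p, p \in l -> (p.1, phi p.1) \in s) ->
  tfold attach_stepf (enc_list (@enc_pair n) l) (enc_list (@enc_pair n) s)
    (enc_state o ve)
  = enc_state (catrev (map snd l) o) (foldl (attach phi) ve l).
Proof.
move=> sphi; elim: l o ve => [|[j i] l IHl] o ve lphi //=.
rewrite -IHl => [|p pl]; last by apply: lphi; rewrite inE pl orbT.
congr tfold; rewrite /attach_stepf /= tmem_enc /attach /=.
by case: ifP => //= _; rewrite (tlookup_enc sphi (lphi _ (mem_head _ _))).
Qed.

(* A facility i is attached on behalf of a client j that it serves, at a price
   at most [dist j i + dist j (phi1 j)]; attached facilities being distinct, so
   are these clients. *)
Lemma foldl_attach_tree I (phi1 phi2 : 'I_(nverts I) -> 'I_(nverts I))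
    (S1 : {set 'I_(nverts I)}) (K : rat) (l : seq ('I_(nverts I) * 'I_(nverts I)))
    (ve : seq 'I_(nverts I) * seq ('I_(nverts I) * 'I_(nverts I))) :
  let inv (ve : seq 'I_(nverts I) * seq ('I_(nverts I) * 'I_(nverts I))) :=
    [/\ is_tree [set x in ve.1] [set e in ve.2],
        {subset S1 <= ve.1} &
        \sum_(e in [set e in ve.2]) dist e.1 e.2 <=
        K + \sum_(j in clients I | (phi2 j \in ve.1) && (phi2 j \notin S1))
              (dist j (phi2 j) + dist j (phi1 j))] in
  (forall p, p \in l ->
     [/\ p.1 \in clients I, p.2 = phi2 p.1 & phi1 p.1 \in S1]) ->
  inv ve ->
  inv (foldl (attach phi1) ve l) /\
  {subset map snd l ++ ve.1 <= (foldl (attach phi1) ve l).1}.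
Proof.
move=> inv; elim: l ve => [|[j i] l IHl] ve lP vP /=.
  by split=> // x.
have [/= jC Ei jS] := lP _ (mem_head _ _).
have {}lP p : p \in l ->
    [/\ p.1 \in clients I, p.2 = phi2 p.1 & phi1 p.1 \in S1].
  by move=> pl; apply: lP; rewrite inE pl orbT.
rewrite {2 4}/attach /=; case: ifP => iv.
  have [vP' sub] := IHl _ lP vP; split=> // x.
  by rewrite inE => /predU1P[->|/sub //]; apply: sub; rewrite mem_cat iv orbT.
have [vP' sub] : inv (foldl (attach phi1) (i :: ve.1, (i, phi1 j) :: ve.2) l) /\
   {subset map snd l ++ i :: ve.1 <=
     (foldl (attach phi1) (i :: ve.1, (i, phi1 j) :: ve.2) l).1}.
  apply: IHl lP _; have [tP S1v sP] := vP.
  have z_v := S1v _ jS.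
  split=> /=.
  - rewrite !set_cons; apply: is_tree_leaf => //; first by rewrite inE.
    by rewrite inE iv.
  - by move=> x /S1v xv; rewrite inE xv orbT.
  - rewrite set_cons big_setU1 /=; last first.
      apply/negP => /(let: And4 gE _ _ _ := tP in gE _ _)[].
      by rewrite inE iv.
    (* The new edge is charged to [j]; its facility [i] is outside [S1] because [S1] is contained in
       the old vertex list. *)
    rewrite [X in K + X](bigD1 j) /=; last first.
      rewrite jC -Ei mem_head /=; apply: contraFN iv; exact: S1v.
    rewrite addrCA; apply: lerD.
      by rewrite -Ei (dist_sym j i) dist_triangle.
    (* Clients charged earlier remain in the sum and differ from [j], since their facilities were
       already in the tree. *)
    apply: le_trans sP _; rewrite lerD2l [leLHS]big_mkcond [leRHS]big_mkcond.
    apply: ler_sum => k _; rewrite inE.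
    case: (boolP (k \in clients I)) => //= kC.
    case: (boolP (phi2 k \in ve.1)) => [kv|_] /=.
      rewrite orbT /=; case: (eqVneq k j) => [kj|_]; last by rewrite andbT.
      by move: iv; rewrite Ei -kj kv.
    by case: ifP => // _; rewrite addr_ge0 ?dist_ge0.
split=> // x; rewrite inE mem_cat => xP; apply: sub.
by move: xP; rewrite mem_cat inE; case: eqP => //=; rewrite ?orbT // => _ ->.
Qed.

(* A facility serving no client is closed: it could not be attached cheaply. *)
Lemma combine_solutions (R : realType) X I (gcap gcard : R)
    (s1 s2 : solution (nverts I)) y1 y2 :
  feasible ConFL (1 : R) 1 s1 -> feasible (Cap X) gcap gcard s2 ->
  describes ConFL s1 y1 -> describes (Cap X) s2 y2 ->
  exists s : solution (nverts I),
    [/\ describes (ConCap X) s (combinef (Node y1 y2)),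
        feasible (ConCap X) gcap gcard s &
        cost (ConCap X) s <= cost ConFL s1 + 2 * cost (Cap X) s2].
Proof.
move=> [oF1 aO1 _ _ /(_ isT)[tree1 oT1]] [oF2 aO2 cap2 card2 _].
move=> [o1 [a1 [v1 [e1 [-> _ [sa1 -> ma1] [sv1 -> mv1] [se1 -> me1]]]]]].
move=> [o2 [a2 [v2 [e2 [-> _ [sa2 -> ma2] _ _]]]]].
have sa1P p : p \in sa1 -> p.2 = assign s1 p.1.
  by rewrite -ma1 => /imsetP[j _ ->].
have sa2P p : p \in sa2 -> p.1 \in clients I /\ p.2 = assign s2 p.1.
  by rewrite -ma2 => /imsetP[j jC ->].
have mem1 p : p \in sa2 -> (p.1, assign s1 p.1) \in sa1.
  by move=> /sa2P[pC _]; rewrite -ma1; apply: imset_f.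
pose ve := foldl (attach (assign s1)) (sv1, se1) sa2.
have out : combinef (Node (enc_list id [:: o1; enc_list (@enc_pair _) sa1;
      enc_list (@enc_ord _) sv1; enc_list (@enc_pair _) se1])
    (enc_list id [:: o2; enc_list (@enc_pair _) sa2]))
  = enc_list id [:: enc_list (@enc_ord _) (catrev (map snd sa2) [::]);
      enc_list (@enc_pair _) sa2; enc_list (@enc_ord _) ve.1;
      enc_list (@enc_pair _) ve.2].
  by rewrite /combinef /= -[Node Leaf _]/(enc_state [::] (sv1, se1)) (tfold_attach _ _ sa1P).
have sv1E : [set x in sv1] = tverts s1 by apply/setP=> x; rewrite inE mv1.
have se1E : [set e in se1] = tedges s1 by apply/setP=> x; rewrite inE me1.
have [] := @foldl_attach_tree I (assign s1) (assign s2) (tverts s1)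
  (\sum_(e in tedges s1) dist e.1 e.2) sa2 (sv1, se1).
- move=> p /sa2P[pC ->]; split=> //; exact: (subsetP oT1 _ (aO1 _ pC)).
- split=> /=; first by rewrite sv1E se1E.
    by move=> x; rewrite mv1.
  rewrite se1E lerDl sumr_ge0 // => j _; by rewrite addr_ge0 ?dist_ge0.
rewrite -/ve => -[treeve _ costve] subve.
pose O := assign s2 @: clients I.
have memO : O =i map snd sa2.
  move=> i; apply/imsetP/mapP => [[j jC ->]|[p /sa2P[pC E] ->]]; last by exists p.1.
  by exists (j, assign s2 j) => //; rewrite -ma2 imset_f.
have subO : O \subset opened s2.
  by apply/subsetP => _ /imsetP[j jC ->]; exact: aO2.
exists (Solution O (assign s2) [set x in ve.1] [set e in ve.2]); split.
- rewrite out; do 4!eexists; split; first by [].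
  + exists (catrev (map snd sa2) [::]) => // i.
    by rewrite catrevE cats0 mem_rev memO.
  + by exists sa2.
  + by exists ve.1 => // x; rewrite inE.
  + by exists ve.2 => // x; rewrite inE.
- split=> /=.
  + exact: subset_trans oF2.
  + by move=> j jC; exact: imset_f.
  (* The assignment is that of [s2], so the loads are unchanged. *)
  + by move=> _ i /(subsetP subO); exact: cap2.
  + move=> bX; apply: le_trans (card2 bX).
    by rewrite ler_nat subset_leq_card.
  + move=> _; split=> //; apply/subsetP => i; rewrite memO inE => iO.
    by apply: subve; rewrite mem_cat iO.
- rewrite /cost /= addr0.
  have le_open : \sum_(i in O) ocost i <= \sum_(i in opened s2) ocost i.
    rewrite [leLHS]big_mkcond [leRHS]big_mkcond ler_sum // => i _.
    case: (boolP (i \in O)) => [/(subsetP subO)->//|_].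
    by case: ifP => // /(subsetP oF2); exact: ocost_ge0.
  have open1 : 0 <= \sum_(i in opened s1) ocost i.
    by rewrite sumr_ge0 // => i /(subsetP oF1); exact: ocost_ge0.
  have open2 : 0 <= \sum_(i in opened s2) ocost i.
    by rewrite sumr_ge0 // => i /(subsetP oF2); exact: ocost_ge0.
  (* The new edges cost at most both service costs: that of [s2] is then paid twice, whence the
     factor 2, and that of [s1] once. *)
  have : \sum_(j in clients I | (assign s2 j \in ve.1) &&
        (assign s2 j \notin tverts s1))
      (dist j (assign s2 j) + dist j (assign s1 j)) <=
    \sum_(j in clients I) dist j (assign s2 j) +
    \sum_(j in clients I) dist j (assign s1 j).
    rewrite -big_split /= big_mkcondr ler_sum // => j _.
    by case: ifP => // _; rewrite addr_ge0 ?dist_ge0.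
  move: costve; lra.
Qed.

(** * Relaxations and the final algorithm *)

Lemma feasible_ConFL (R : realType) X I (s : solution (nverts I)) :
  feasible (ConCap X) (1 : R) 1 s -> feasible ConFL (1 : R) 1 s.
Proof. by case=> oF aO _ _ tP; split. Qed.

Lemma feasible_Cap (R : realType) X I (s : solution (nverts I)) :
  feasible (ConCap X) (1 : R) 1 s -> feasible (Cap X) (1 : R) 1 s.
Proof. by case=> oF aO cP bP _; split. Qed.

Lemma cost_Cap_le X I (s : solution (nverts I)) :
  cost (Cap X) s <= cost (ConCap X) s.
Proof.
by rewrite /cost /= addr0 lerDl sumr_ge0 // => e _; exact: dist_ge0.
Qed.

Definition connect_prog (p1 p2 : prog) : prog :=
  PSeq (PCons (PSeq strip p1) p2) combine.

Lemma eval_connect_prog p1 p2 X I y1 t1 y2 t2 :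
  eval p1 (enc_instance ConFL I) y1 t1 ->
  eval p2 (enc_instance (Cap X) I) y2 t2 ->
  exists t, eval (connect_prog p1 p2) (enc_instance (ConCap X) I)
    (combinef (Node y1 y2)) t.
Proof.
move=> e1 e2; have [_ _ /(_ (enc_instance (ConCap X) I))[ts es _]] := ptime_strip.
have [_ _ /(_ (Node y1 y2))[tc ec _]] := ptime_combine.
(* Connectivity does not enter the encoding, so [p2] runs on the original input. *)
eexists; apply: (EvSeq _ ec); apply: EvCons e2.
rewrite stripE in es; exact: EvSeq es e1.
Qed.

Lemma connect_prog_poly p1 p2 X :
  polynomial_time ConFL p1 -> polynomial_time (Cap X) p2 ->
  polynomial_time (ConCap X) (connect_prog p1 p2).
Proof.
move=> [C1 [d1 P1]] [C2 [d2 P2]].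
have [hs bs es] := ptime_strip; have [hc bc ec] := ptime_combine.
pose h1 n := (C1 * n ^ d1)%N; pose h2 n := (C2 * n ^ d2)%N.
have b1 : poly_bound h1 := poly_bound_monomial C1 d1.
have b2 : poly_bound h2 := poly_bound_monomial C2 d2.
pose h n := (n + (n + hs n + h1 (hs n)) + h2 n)%N.
have bh : poly_bound h.
  do !apply: poly_bound_add=> //; try exact: poly_bound_id.
  exact: poly_bound_comp.
have [|C [d Cd]] := @poly_bound_pos (fun n => n + h n + hc (h n))%N.
  apply: poly_bound_add; last exact: poly_bound_comp.
  by apply: poly_bound_add => //; exact: poly_bound_id.
exists C, d => I XI; set x := enc_instance _ I.
have [ts Es ls] := es x; rewrite stripE in Es.
have [//|y1 [t1 [E1 l1]]] := P1 I.
have [y2 [t2 [E2 l2]]] := P2 I XI.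
have [tc Ec lc] := ec (Node y1 y2).
have E := EvCons (EvSeq Es E1) E2.
exists (combinef (Node y1 y2)), (tsize x + (tsize x + (tsize x + ts + t1) + t2) + tc)%N.
split; first exact: EvSeq E Ec.
apply: leq_trans (Cd _ (tsize_gt0 x)).
have l1' : (t1 <= h1 (hs (tsize x)))%N.
  by apply: leq_trans l1 _; apply: b1.1; exact: leq_trans (tsize_eval Es) ls.
have lh : (tsize x + (tsize x + ts + t1) + t2 <= h (tsize x))%N.
  have l2' : (t2 <= h2 (tsize x))%N := l2.
  by rewrite /h; lia.
(* The size of [Node y1 y2] is at most the time spent producing it, so [combine] takes time at most
   [hc (h (tsize x))]. *)
have := bc.1 _ _ (leq_trans (tsize_eval E) lh); lia.
Qed.

Theorem theorem1 (R : realType) (X : variant) (w : violation)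
    (alpha beta gamma : R) :
  has_approximation ConFL alpha 1 1 ->
  has_approximation (Cap X) beta (cap_factor w gamma) (card_factor w gamma) ->
  has_approximation (ConCap X) (alpha + 2 * beta)
    (cap_factor w gamma) (card_factor w gamma).
Proof.
move=> [p1 [poly1 app1]] [p2 [poly2 app2]].
exists (connect_prog p1 p2); split; first exact: connect_prog_poly.
(* Nonnegative factors preserve the inequalities between the relaxed optima and the connected
   one. *)
have a0 := approximates_ge0 app1; have b0 := approximates_ge0 app2.
move=> I XI opt [[s fs <-] _].
have [s1 [fs1 os1]] := feasible_optimum (feasible_ConFL fs).
have [s2 [fs2 os2]] := feasible_optimum (feasible_Cap fs).
have [//|y1 [t1 [r1 [E1 D1 F1 c1]]]] := app1 I _ _ os1.
have [//|y2 [t2 [r2 [E2 D2 F2 c2]]]] := app2 I _ _ os2.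
have [r [Dr Fr cr]] := combine_solutions F1 F2 D1 D2.
have [t E] := eval_connect_prog E1 E2.
exists (combinef (Node y1 y2)), t, r; split=> //.
have le1 : ratr (cost ConFL s1) <= ratr (cost (ConCap X) s) :> R.
  by rewrite ler_rat (os1.2 _ (feasible_ConFL fs)).
have le2 : ratr (cost (Cap X) s2) <= ratr (cost (ConCap X) s) :> R.
  by rewrite ler_rat (le_trans (os2.2 _ (feasible_Cap fs))) // cost_Cap_le.
move: cr; rewrite -(ler_rat R) [ratr (_ + 2 * _)]rmorphD rmorphM /= ratr_nat => cr.
apply: le_trans cr _; rewrite [leRHS]mulrDl -mulrA.
apply: lerD; first by apply: le_trans c1 _; rewrite ler_wpM2l.
by rewrite ler_wpM2l // (le_trans c2) // ler_wpM2l.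
Qed.
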